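(* Let $G$ be a profinite group and $k$ a field of characteristic $p$ (a prime or zero). The following conditions are equivalent: (a) The category ${}_G^d\mathrm{Vect}$ of discrete $G$-modules over $k$ has a non-zero projective object. (b) The category ${}_G^d\mathrm{Vect}$ has enough projective objects. (c) The characteristic $p$ of $k$ has finite exponent in the supernatural number $|G|$ (by convention this condition holds vacuously when $p=0$).
   Context: ${}_G^d\mathrm{Vect}$ is the category of discrete $G$-modules over $k$: $k$-vector spaces $M$ with a $k$-linear left action of $G$ such that $G\times M\to M$ is continuous when $M$ has the discrete topology (equivalently, every element of $M$ is fixed by some open normal subgroup of $G$), with $k$-linear $G$-equivariant maps as morphisms. Projectivity is meant in this category; it has enough projective objects if every object is a quotient of a projective object. A supernatural number is a formal product $\prod_{\ell\text{ prime}}\ell^{n_\ell}$ with $n_\ell\in\mathbb{Z}_{\ge 0}\cup\{\infty\}$. The order $|G|$ of a profinite group $G$ is the supernatural number defined as the least common multiple of the orders $|G/H|$, where $H$ ranges over the open normal subgroups of $G$. The exponent of a prime $\ell$ in $|G|$ is the corresponding $n_\ell$. *)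

(* Defs.v *)
From HB Require Import structures.
From mathcomp Require Import all_boot all_order all_algebra.
From mathcomp Require Import all_classical topology.

Set Implicit Arguments.
Unset Strict Implicit.
Unset Printing Implicit Defensive.

Import GRing.Theory.

Local Open Scope classical_set_scope.
Local Open Scope card_scope.
Local Open Scope ring_scope.

HB.mixin Record isTopologicalGroup G of Topological G & Group G := {
  mulg_continuous : continuous (fun x : G * G => (x.1 * x.2)%g);
  invg_continuous : continuous (fun x : G => (x^-1)%g)
}.

#[short(type="topologicalGroupType")]
HB.structure Definition TopologicalGroup :=
  {G of Topological G & Group G & isTopologicalGroup G}.

Definition profinite (G : topologicalGroupType) : Prop :=
  [/\ compact [set: G], hausdorff_space G & totally_disconnected [set: G]].

Definition open_normal_subgroup (G : topologicalGroupType) (H : set G) : Prop :=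
  [/\ open H,
      H 1%g,
      forall x y, H x -> H y -> H (x * y)%g,
      forall x, H x -> H (x^-1)%g &
      forall x g, H x -> H (x ^ g)%g].

Definition left_coset (G : groupType) (H : set G) (g : G) : set G :=
  [set (g * h)%g | h in H].

(* The underlying set of G / H. *)
Definition left_cosets (G : groupType) (H : set G) : set (set G) :=
  range (left_coset H).

(* The formal product of the l ^ (n l) over all primes l is encoded by the
   family n of its exponents, where None stands for the exponent infinity. *)
Definition supernatural : Type := {l : nat | prime l} -> option nat.

Definition exponent_le (a b : option nat) : bool :=
  match a, b with
  | _, None => true
  | None, Some _ => false
  | Some m, Some n => (m <= n)%N
  end.

Definition supernatural_dvd (s t : supernatural) : Prop :=
  forall l, exponent_le (s l) (t l).

(* Only meaningful for n > 0. *)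
Definition supernatural_of_nat (n : nat) : supernatural :=
  fun l => Some (logn (val l) n).

Definition exponent_sup (E : set (option nat)) : option nat :=
  match pselect (exists n, `[< forall e, E e -> exponent_le e (Some n) >]) with
  | left bounded => Some (ex_minn bounded)
  | right _ => None
  end.

Definition supernatural_lcm (S : set supernatural) : supernatural :=
  fun l => exponent_sup [set s l | s in S].

Lemma supernatural_lcm_ub (S : set supernatural) s :
  S s -> supernatural_dvd s (supernatural_lcm S).
Proof.
move=> Ss l; rewrite /supernatural_lcm /exponent_sup.
case: pselect => [b|_]; last by case: (s l).
by case: ex_minnP => m /asboolP ub _; apply: ub; exists s.
Qed.

Lemma supernatural_lcm_least (S : set supernatural) t :
  (forall s, S s -> supernatural_dvd s t) ->
  supernatural_dvd (supernatural_lcm S) t.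
Proof.
move=> tub l; rewrite /supernatural_lcm /exponent_sup.
case tl: (t l) => [n|]; last by case: pselect.
have ubn : `[< forall e, [set s l | s in S] e -> exponent_le e (Some n) >].
  by apply/asboolP => _ [s Ss <-]; rewrite -tl; exact: tub.
case: pselect => [b|]; last by case; exists n.
by case: ex_minnP => m _ /(_ n ubn).
Qed.

(* In a profinite group all the quotients G / H below are finite. *)
Definition group_order (G : topologicalGroupType) : supernatural :=
  supernatural_lcm
    [set s | exists (H : set G) (n : nat),
       [/\ open_normal_subgroup H,
           left_cosets H #= `I_n &
           s = supernatural_of_nat n]].

Definition has_finite_exponent (p : nat) (s : supernatural) : Prop :=
  forall l, val l = p -> s l <> None.

(* [pchar k] is the set of primes vanishing in k, so it is empty in
   characteristic 0. *)
Definition has_characteristic (k : fieldType) (p : nat) : Prop :=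
  (p = 0%N /\ [pchar k] =i pred0) \/ p \in [pchar k].

Section DiscreteModules.
Variables (G : topologicalGroupType) (k : fieldType).

Record discreteModule := DiscreteModule {
  dm_carrier :> lmodType k;
  dm_act : G -> {linear dm_carrier -> dm_carrier};
  dm_act1 : forall v, dm_act 1%g v = v;
  dm_actM : forall g h v, dm_act (g * h)%g v = dm_act g (dm_act h v);
  dm_act_continuous :
    continuous ((fun x => dm_act x.1 x.2) :
      G * discrete_topology dm_carrier -> discrete_topology dm_carrier)
}.

Record dm_hom (M N : discreteModule) := DmHom {
  dm_hom_fun :> {linear M -> N};
  dm_homJ : forall g v, dm_hom_fun (dm_act M g v) = dm_act N g (dm_hom_fun v)
}.

Definition dm_epi (M N : discreteModule) (f : dm_hom M N) : Prop :=
  forall (X : discreteModule) (u v : dm_hom N X), u \o f =1 v \o f -> u =1 v.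

Definition dm_projective (P : discreteModule) : Prop :=
  forall (M N : discreteModule) (f : dm_hom M N) (g : dm_hom P N),
    dm_epi f -> exists h : dm_hom P M, f \o h =1 g.

Definition dm_nonzero (M : discreteModule) : Prop := exists v : M, v != 0.

Definition has_nonzero_projective : Prop :=
  exists P : discreteModule, dm_projective P /\ dm_nonzero P.

Definition dm_quotient_of (M P : discreteModule) : Prop :=
  exists f : dm_hom P M, forall v : M, exists w : P, f w = v.

Definition has_enough_projectives : Prop :=
  forall M : discreteModule, exists P : discreteModule,
    dm_projective P /\ dm_quotient_of M P.

End DiscreteModules.

(* Main.v *)
Require Import Defs.
From HB Require Import structures.
From mathcomp Require Import all_boot all_order all_algebra.
From mathcomp Require Import finmap all_classical topology.

(** Compactness of G enters in two ways: the index of every open normal subgroup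
    is finite (exists_transversal), and every stabiliser of a vector of a
    discrete module contains an open normal subgroup (fixing_subgroup).

    Everything rests on the modules Q = (+)_i k[G/N_i], with N_i open normal.
    A map Q -> A is a family of vectors a_i of A fixed by N_i, so each module
    M is a quotient of such a Q, indexed by the vectors v of M, where N_v may be
    chosen as small as one likes among the groups that fix v (perm_ext_surj).

    (c) => (b).  If the exponent of p is finite, choose an open normal H whose
    index has maximal p-part (H = G if p = 0).  The indices inside H are then
    invertible in k (finite_exponent_invertible_index).  For N_i inside H, a preimage in A of an
    N_i-fixed vector of a quotient of A can be averaged over the finitely many
    cosets in N_i of a subgroup that fixes it, so Q is projective
    (perm_module_projective).  In the category-theoretic definition of
    projectivity the test maps are epimorphisms; these are surjective because
    cokernels exist (dm_epi_surj).

    (a) => (c).  Let P be projective, let v in P be fixed by the open normal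
    subgroup N, and suppose that the exponent of p is infinite.  For each w in P
    choose L_w inside N and fixing w, and then K_w inside L_w with p dividing
    [L_w : K_w].  The surjection q from Q = (+)_w k[G/K_w] to P has a section s.
    Write s(v) = phi; then v = q(phi) is the sum over w of the sums of
    phi_w(x) x w over x in G/K_w.  Since phi is N-invariant and N is normal, the
    summand depends only on the class of x modulo L_w, so each inner sum is a
    multiple of [L_w : K_w], which is 0 in k.  Hence v = 0.

    (b) => (a).  A projective that maps onto the trivial module k is not 0. *)

Set Implicit Arguments.
Unset Strict Implicit.
Unset Printing Implicit Defensive.

Import GRing.Theory.

Local Open Scope classical_set_scope.
Local Open Scope card_scope.
Local Open Scope ring_scope.

(** * Open normal subgroups *)

Section OpenNormalSubgroups.
Variable G : topologicalGroupType.
Implicit Types (x y g : G) (N H L : set G).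

Lemma open_normal_open N : open_normal_subgroup N -> open N.
Proof. by case. Qed.

Lemma open_normal1 N : open_normal_subgroup N -> N 1%g.
Proof. by case. Qed.

Lemma open_normalM N x y :
  open_normal_subgroup N -> N x -> N y -> N (x * y)%g.
Proof. by case=> _ _ NM _ _; exact: NM. Qed.

Lemma open_normalV N x : open_normal_subgroup N -> N x -> N x^-1%g.
Proof. by case=> _ _ _ NV _; exact: NV. Qed.

Lemma open_normalJ N x g : open_normal_subgroup N -> N x -> N (x ^ g)%g.
Proof. by case=> _ _ _ _ NJ; exact: NJ. Qed.

Lemma open_normal_div N x y : open_normal_subgroup N ->
  N (x^-1 * y)%g -> N (y^-1 * x)%g.
Proof. by move=> nN /(open_normalV nN); rewrite invgM invgK. Qed.

Lemma open_normalMr N x n :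
  open_normal_subgroup N -> N n -> `[< N (x * n)%g >] = `[< N x >].
Proof.
move=> nN Nn; apply/asboolP/asboolP => Nx; last exact: open_normalM.
by rewrite -[x](mulgK n); apply: open_normalM => //; exact: open_normalV.
Qed.

Lemma open_normalMl N x n :
  open_normal_subgroup N -> N n -> `[< N (n * x)%g >] = `[< N x >].
Proof.
move=> nN Nn; apply/asboolP/asboolP => Nx; last exact: open_normalM.
by rewrite -[x](mulKg n); apply: open_normalM => //; exact: open_normalV.
Qed.

Lemma open_normalT : open_normal_subgroup [set: G].
Proof. by split=> //; exact: openT. Qed.

Lemma open_normalI N H : open_normal_subgroup N -> open_normal_subgroup H ->
  open_normal_subgroup (N `&` H).
Proof.
move=> [oN N1 NM NV NJ] [oH H1 HM HV HJ]; split=> //; first exact: openI.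
- by move=> x y [? ?] [? ?]; split; [exact: NM|exact: HM].
- by move=> x [? ?]; split; [exact: NV|exact: HV].
- by move=> x g [? ?]; split; [exact: NJ|exact: HJ].
Qed.

Lemma continuous_mulgl g : continuous (fun x => (g * x)%g).
Proof.
move=> x; apply: (@cvg_comp _ _ _ (fun y => (g, y)) (fun z => (z.1 * z.2)%g)
  _ (nbhs (g, x))); last exact: (@mulg_continuous G (g, x)).
by apply: cvg_pair; [exact: cvg_cst|exact: cvg_id].
Qed.

Lemma open_translate N g :
  open N -> open [set x : G | N (g^-1 * x)%g].
Proof.
by move=> oN; apply: (open_comp _ oN) => x _; exact: continuous_mulgl.
Qed.

Lemma compact_finite_cover (f : G -> set G) : compact [set: G] ->
  (forall g, open (f g)) -> (forall g, f g g) ->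
  exists s : seq G, forall x, exists2 g, g \in s & f g x.
Proof.
move=> cG fo fg.
pose pG : ptopologicalType :=
  HB.pack (G : Type) (isPointed.Build G 1%g) (Topological.class G).
have := cG; rewrite -[compact]/(@compact pG) compact_cover.
case/(_ G [set: G] f) => [g _|x _|D _ Dc].
- exact: fo.
- by exists x; [|exact: fg].
- by exists (enum_fset D) => x; have [//|g gD fgx] := Dc x; exists g.
Qed.

End OpenNormalSubgroups.

(** * Sums over coset representatives *)

Section Transversals.
Variable G : topologicalGroupType.
Hypothesis cG : compact [set: G].
Implicit Types (x y g : G) (N H L : set G) (s T : seq G).

(** A [k]-fold transversal.  Multiplicities are allowed because a transversal of
    a smaller subgroup is a multiple transversal of a larger one. *)
Definition covers_cosets N k s :=
  forall x, count (fun t => `[< N (x^-1 * t)%g >]) s = k.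

Definition right_invariant (V : Type) N (F : G -> V) :=
  forall x n, N n -> F (x * n)%g = F x.

Lemma sumr_count (V : nmodType) (I : Type) (r : seq I) (P : pred I) (v : V) :
  \sum_(i <- r | P i) v = v *+ count P r.
Proof. by rewrite big_const_seq iter_addr_0. Qed.

(** All facts on sums over [G/N] below come from this one: independence of the
    transversal, invariance under translation, and the factor [L : N] that
    appears when [N] is replaced by a larger [L]. *)
Lemma sum_covers_cosets (V : nmodType) N k T s (F : G -> V) :
  open_normal_subgroup N -> covers_cosets N 1 T -> covers_cosets N k s ->
  right_invariant N F -> \sum_(t <- s) F t = (\sum_(t <- T) F t) *+ k.
Proof.
move=> nN NT Ns FN.
(* Sum over the pairs in s x T that represent the same coset, in both
   orders. *)
transitivity (\sum_(t <- s) \sum_(u <- T | `[< N (t^-1 * u)%g >]) F t).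
  by apply: eq_bigr => t _; rewrite sumr_count NT.
rewrite (exchange_big_dep predT) //= -sumrMnl; apply: eq_bigr => u _.
rewrite -(Ns u) -sumr_count; apply: eq_big => [t|t /asboolP Ntu].
  by apply/asboolP/asboolP; exact: open_normal_div.
by rewrite -(mulVKg u t) FN //; exact: open_normal_div.
Qed.

Lemma left_cosetP N g x : left_coset N g x <-> N (g^-1 * x)%g.
Proof.
split=> [[n Nn <-]|Nx]; first by rewrite mulKg.
by exists (g^-1 * x)%g => //; rewrite mulVKg.
Qed.

Lemma left_coset_eqP N g x : open_normal_subgroup N ->
  N (g^-1 * x)%g <-> left_coset N g = left_coset N x.
Proof.
move=> nN; split=> [Ngx|e]; last first.
  by apply/left_cosetP; rewrite e; apply/left_cosetP; rewrite mulVg;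
     exact: open_normal1.
apply/seteqP; split=> y /left_cosetP Ny; apply/left_cosetP.
  have := open_normalM nN (open_normal_div nN Ngx) Ny.
  by rewrite mulgA mulgK.
by have := open_normalM nN Ngx Ny; rewrite mulgA mulgK.
Qed.

Lemma exists_transversal N : open_normal_subgroup N ->
  exists T, covers_cosets N 1 T.
Proof.
move=> nN; have [|g|s sc] :=
    @compact_finite_cover G (fun g => [set x | N (g^-1 * x)%g]) cG.
- by move=> g; apply: open_translate; exact: open_normal_open.
- by rewrite /= mulVg; exact: open_normal1.
pose r (C : set G) := xget 1%g C.
pose cs := undup (map (left_coset N) s).
have rP g : N (g^-1 * r (left_coset N g))%g.
  apply/left_cosetP; apply: (@xgetPex _ _ (left_coset N g)); exists g.
  by apply/left_cosetP; rewrite mulVg; exact: open_normal1.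
exists (map r cs) => x; rewrite count_map.
rewrite (_ : count _ _ = count_mem (left_coset N x) cs); last first.
  apply: eq_in_count => C; rewrite mem_undup => /mapP[g _ ->] /=.
  apply/asboolP/eqP => [Nxg|->]; last exact: rP.
  apply/(left_coset_eqP _ _ nN).
  have := open_normalM nN (rP g) (open_normal_div nN Nxg).
  by rewrite mulgA mulgK.
rewrite count_uniq_mem ?undup_uniq // mem_undup.
suff -> : left_coset N x \in map (left_coset N) s by [].
by have [g gs /= /(left_coset_eqP _ _ nN) <-] := sc x; apply: map_f.
Qed.

Definition coset_reps N : seq G := xget [::] (covers_cosets N 1).

Lemma coset_repsP N :
  open_normal_subgroup N -> covers_cosets N 1 (coset_reps N).
Proof. by move=> /exists_transversal; exact: xgetPex. Qed.

(** The sum of [F] over [G/N], meaningful when [F] is constant on the left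
    cosets of [N]. *)
Definition coset_sum (V : nmodType) N (F : G -> V) : V :=
  \sum_(t <- coset_reps N) F t.

(** When [N] is contained in the subgroup [L], this is the index [L : N]. *)
Definition rel_index L N : nat := count (fun t => `[< L t >]) (coset_reps N).

Lemma covers_cosets_translate N k s g :
  covers_cosets N k s -> covers_cosets N k [seq (g * t)%g | t <- s].
Proof.
move=> Ns x; rewrite count_map -(Ns (g^-1 * x)%g); apply: eq_count => t /=.
by rewrite invgM invgK mulgA.
Qed.

Lemma coset_sum_translate (V : nmodType) N (F : G -> V) g :
  open_normal_subgroup N -> right_invariant N F ->
  coset_sum N (fun x => F (g * x)%g) = coset_sum N F.
Proof.
move=> nN FN; have NT := coset_repsP nN.
have := sum_covers_cosets nN NT (covers_cosets_translate g NT) FN.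
by rewrite big_map mulr1n.
Qed.

(** The number of representatives of [G/N] in a coset [xL] does not depend on
    [x], by translation invariance of the sum of the indicator of [L]. *)
Lemma covers_cosets_sub N L :
  open_normal_subgroup N -> open_normal_subgroup L -> N `<=` L ->
  covers_cosets L (rel_index L N) (coset_reps N).
Proof.
move=> nN nL NL x.
rewrite /rel_index -!sum1_count big_mkcond [RHS]big_mkcond /=.
have FN : right_invariant N (fun t => if `[< L t >] then 1%N else 0%N).
  by move=> y n /NL Ln; rewrite open_normalMr.
exact: (@coset_sum_translate nat N _ x^-1%g nN FN).
Qed.

Lemma coset_sum_sub (V : nmodType) N L (F : G -> V) :
  open_normal_subgroup N -> open_normal_subgroup L -> N `<=` L ->
  right_invariant L F -> coset_sum N F = coset_sum L F *+ rel_index L N.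
Proof.
move=> nN nL NL FL.
exact: (sum_covers_cosets nL (coset_repsP nL) (covers_cosets_sub nN nL NL) FL).
Qed.

Lemma index_mul N L :
  open_normal_subgroup N -> open_normal_subgroup L -> N `<=` L ->
  size (coset_reps N) = (size (coset_reps L) * rel_index L N)%N.
Proof.
move=> nN nL NL; have := @coset_sum_sub nat _ _ (fun=> 1%N) nN nL NL.
by rewrite /coset_sum !sum1_size => -> //; rewrite -mulr_natr natn.
Qed.

Lemma coset_reps_gt0 N : open_normal_subgroup N -> (0 < size (coset_reps N))%N.
Proof.
by move=> nN; case: coset_reps (coset_repsP nN) => // /(_ 1%g).
Qed.

Lemma card_left_cosets N :
  open_normal_subgroup N -> left_cosets N #= `I_(size (coset_reps N)).
Proof.
move=> nN; pose s := map (left_coset N) (coset_reps N).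
have sP x : count_mem (left_coset N x) s = 1%N.
  rewrite -(coset_repsP nN x) count_map; apply: eq_count => t /=.
  apply/eqP/asboolP => [/esym|Nxt]; first by move=> /(left_coset_eqP _ _ nN).
  by apply/esym/(left_coset_eqP _ _ nN).
have us : uniq s.
  apply: count_mem_uniq => C; have [/mapP[t _ ->]|Cs] := boolP (C \in s).
    exact: sP.
  exact/count_memPn.
have -> : left_cosets N = [set` [fset C in s]%fset].
  apply/seteqP; split=> C /=; rewrite inE.
    by move=> [x _ <-]; rewrite -has_pred1 has_count sP.
  by move=> /mapP[t _ ->]; exists t.
apply/card_eq_fsetP.
by rewrite card_fseq undup_id // size_map.
Qed.

End Transversals.

(** * Discrete modules *)

Section DiscreteModuleTheory.
Variables (G : topologicalGroupType) (k : fieldType).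
Hypothesis cG : compact [set: G].
Implicit Types (x y g : G) (N H L : set G) (M A B P : discreteModule G k).

Lemma open_act_eq M (v w : M) : open [set g : G | dm_act M g v = w].
Proof.
rewrite openE => g /= gv.
have cv : (fun x : G => dm_act M x v : discrete_topology M) @ g -->
    (dm_act M g v : discrete_topology M).
  apply: (@cvg_comp _ _ _ (fun y => (y, v : discrete_topology M))
    (fun z => dm_act M z.1 z.2 : discrete_topology M)
    _ (nbhs (g, v : discrete_topology M))).
    exact: (cvg_pair cvg_id (cvg_cst _)).
  exact: (@dm_act_continuous _ _ M (g, v)).
apply: (cv [set w]); rewrite gv.
exact: (@discrete_set1 (discrete_topology M) w).
Qed.

(** The pointwise stabiliser of the orbit of [v] is normal.  It is open because
    by compactness the orbit is finite. *)
Lemma fixing_subgroup M (v : M) : exists N : set G,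
  open_normal_subgroup N /\ forall n, N n -> dm_act M n v = v.
Proof.
pose S (w : M) := [set g | dm_act M g w = w].
have SM w x y : S w x -> S w y -> S w (x * y)%g.
  by rewrite /S /= dm_actM => Sx ->.
have SV w x : S w x -> S w (x^-1)%g.
  by rewrite /S /= => {1}<-; rewrite -dm_actM mulVg dm_act1.
have [|g|s sc] := @compact_finite_cover G
    (fun g => [set x | dm_act M x v = dm_act M g v]) cG => //.
  by move=> g; exact: open_act_eq.
(* The first description of K shows that it is normal, the second that it is
   open. *)
pose K := [set x | forall g, S (dm_act M g v) x].
have KE : K = [set x | forall g, g \in s -> S (dm_act M g v) x].
  apply/seteqP; split=> x /= Kx g; first by move=> _; exact: Kx.
  by have [h hs /= ->] := sc g; exact: Kx.
exists K; split=> [|n /(_ 1%g)]; last by rewrite /S /= dm_act1.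
split.
- rewrite KE; elim: s {sc KE} => [|h s IHs].
    have -> : [set x | forall g, g \in [::] -> S (dm_act M g v) x] = setT.
      by apply/seteqP; split.
    exact: openT.
  have -> : [set x | forall g, g \in h :: s -> S (dm_act M g v) x] =
      S (dm_act M h v) `&` [set x | forall g, g \in s -> S (dm_act M g v) x].
    apply/seteqP; split=> x /=.
      by move=> Sx; split=> [|g gs]; apply: Sx; rewrite inE ?eqxx // gs orbT.
    by move=> [Shx Sx] g; rewrite inE => /predU1P[->//|]; exact: Sx.
  by apply: openI => //; exact: open_act_eq.
- by move=> g; rewrite /S /= dm_act1.
- by move=> x y Kx Ky g; exact: SM.
- by move=> x Kx g; exact: SV.
- move=> x y Kx g; rewrite /S /= conjgE !dm_actM -(dm_actM y).
  by rewrite (Kx (y * g)%g) dm_actM -dm_actM mulVg dm_act1.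
Qed.

(** Converse of fixing_subgroup, through which all the modules below are shown
    to be discrete. *)
Lemma smooth_continuous (M : lmodType k) (act : G -> {linear M -> M}) :
  (forall g h v, act (g * h)%g v = act g (act h v)) ->
  (forall v, exists N,
     open_normal_subgroup N /\ forall n, N n -> act n v = v) ->
  continuous ((fun z => act z.1 z.2) :
      G * discrete_topology M -> discrete_topology M).
Proof.
move=> actM sm [g v]; apply/discrete_cvg => /=.
have [N [nN Nv]] := sm v.
exists ([set x : G | N (g^-1 * x)%g], [set v : discrete_topology M]) => /=.
  split; last exact: (@discrete_set1 (discrete_topology M) v).
  apply: open_nbhs_nbhs; split; last by rewrite /= mulVg; exact: open_normal1.
  by apply: open_translate; exact: open_normal_open.
move=> [x w] /= [Nx ->].
by rewrite -(mulVKg g x) actM Nv.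
Qed.

End DiscreteModuleTheory.

(** * Epimorphisms are surjective *)

Section Cokernel.
Variables (G : topologicalGroupType) (k : fieldType).
Variables (A B : discreteModule G k) (f : dm_hom A B).

Definition dm_image : {pred B} := [pred w | `[< exists v, f v = w >]].

Lemma dm_imageP w : reflect (exists v, f v = w) (w \in dm_image).
Proof. exact: asboolP. Qed.

Lemma dm_image_zmod_closed : zmod_closed dm_image.
Proof.
split=> [|_ _ /dm_imageP[v <-] /dm_imageP[w <-]]; apply/dm_imageP.
  by exists 0; rewrite linear0.
by exists (v - w); rewrite linearB.
Qed.

HB.instance Definition _ :=
  GRing.isZmodClosed.Build B dm_image dm_image_zmod_closed.

Definition coker : Type := {ideal_quot dm_image}.

HB.instance Definition _ := GRing.Zmodule.on coker.

Definition coker_proj : B -> coker := \pi_({ideal_quot dm_image})%qT.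

Lemma coker_proj_surj q : exists v, coker_proj v = q.
Proof. by exists (repr (q : {ideal_quot dm_image})); exact: reprK. Qed.

Lemma coker_projP v w : coker_proj v = coker_proj w <-> v - w \in dm_image.
Proof.
by rewrite Quotient.idealrBE; split=> /eqP.
Qed.

Lemma coker_proj_is_zmod_morphism : zmod_morphism coker_proj.
Proof. exact: (raddfB \pi_({ideal_quot dm_image})%qT). Qed.

(** The map induced on the cokernel by [u] when [u] preserves the image; both
    the scaling and the action are obtained in this way. *)
Definition coker_lift (u : B -> B) (q : coker) : coker :=
  coker_proj (u (repr (q : {ideal_quot dm_image}))).

Lemma coker_liftE (u : {additive B -> B}) v :
  {homo u : w / w \in dm_image} ->
  coker_lift u (coker_proj v) = coker_proj (u v).
Proof.
move=> uI; apply/coker_projP; rewrite -raddfB; apply/uI/coker_projP.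
exact: reprK.
Qed.

Lemma dm_imageZ a : {homo ( *:%R a) : w / w \in dm_image}.
Proof.
move=> _ /dm_imageP[v <-]; apply/dm_imageP; exists (a *: v).
by rewrite linearZ.
Qed.

Lemma dm_imageJ g : {homo (dm_act B g) : w / w \in dm_image}.
Proof.
move=> _ /dm_imageP[v <-]; apply/dm_imageP; exists (dm_act A g v).
by rewrite dm_homJ.
Qed.

HB.instance Definition _ :=
  GRing.isZmodMorphism.Build B coker coker_proj coker_proj_is_zmod_morphism.

Definition coker_scale (a : k) : coker -> coker := coker_lift ( *:%R a).

Lemma coker_scaleE a v : coker_scale a (coker_proj v) = coker_proj (a *: v).
Proof. exact: coker_liftE (@dm_imageZ a). Qed.

Lemma coker_scaleA a b q :
  coker_scale a (coker_scale b q) = coker_scale (a * b) q.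
Proof. by have [v <-] := coker_proj_surj q; rewrite !coker_scaleE scalerA. Qed.

Lemma coker_scale1 : left_id 1 coker_scale.
Proof.
by move=> q; have [v <-] := coker_proj_surj q; rewrite coker_scaleE scale1r.
Qed.

Lemma coker_scaleDr : right_distributive coker_scale +%R.
Proof.
move=> a q r.
have [[v <-] [w <-]] := (coker_proj_surj q, coker_proj_surj r).
by rewrite -raddfD !coker_scaleE scalerDr raddfD.
Qed.

Lemma coker_scaleDl q : {morph coker_scale^~ q : a b / a + b}.
Proof.
move=> a b; have [v <-] := coker_proj_surj q.
by rewrite !coker_scaleE scalerDl raddfD.
Qed.

HB.instance Definition _ := GRing.Zmodule_isLmodule.Build k coker
  coker_scaleA coker_scale1 coker_scaleDr coker_scaleDl.

Lemma coker_proj_is_scalable : scalable coker_proj.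
Proof. by move=> a v; rewrite -coker_scaleE. Qed.

HB.instance Definition _ :=
  GRing.isScalable.Build k B coker *:%R coker_proj coker_proj_is_scalable.

Definition coker_act (g : G) : coker -> coker := coker_lift (dm_act B g).

Lemma coker_actE g v : coker_act g (coker_proj v) = coker_proj (dm_act B g v).
Proof. exact: coker_liftE (@dm_imageJ g). Qed.

Lemma coker_act_is_linear g : linear (coker_act g).
Proof.
move=> a q r.
have [[v <-] [w <-]] := (coker_proj_surj q, coker_proj_surj r).
by rewrite -linearP !coker_actE !linearP.
Qed.

HB.instance Definition _ g :=
  GRing.isLinear.Build k coker coker *:%R (coker_act g)
    (@coker_act_is_linear g).

Lemma coker_act1 q : coker_act 1%g q = q.
Proof. by have [v <-] := coker_proj_surj q; rewrite coker_actE dm_act1. Qed.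

Lemma coker_actM g h q : coker_act (g * h)%g q = coker_act g (coker_act h q).
Proof. by have [v <-] := coker_proj_surj q; rewrite !coker_actE dm_actM. Qed.

Hypothesis cG : compact [set: G].

Lemma coker_act_continuous :
  continuous ((fun z => coker_act z.1 z.2) :
      G * discrete_topology coker -> discrete_topology coker).
Proof.
apply: (smooth_continuous (act := fun g => coker_act g) coker_actM) => q.
have [v <-] := coker_proj_surj q.
have [N [nN Nv]] := fixing_subgroup cG v.
by exists N; split=> // n /Nv nv; rewrite [LHS]coker_actE nv.
Qed.

Definition coker_module : discreteModule G k :=
  @DiscreteModule G k coker (fun g => coker_act g) coker_act1 coker_actM
    coker_act_continuous.

Definition coker_hom : dm_hom B coker_module :=
  @DmHom G k B coker_module (coker_proj : {linear B -> coker})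
    (fun g v => esym (coker_actE g v)).

Lemma zero_homJ (X : discreteModule G k) g (v : B) :
  (\0 : {linear B -> X}) (dm_act B g v) = dm_act X g ((\0 : {linear B -> X}) v).
Proof. by rewrite linear0. Qed.

Definition zero_hom (X : discreteModule G k) : dm_hom B X :=
  @DmHom G k B X \0 (@zero_homJ X).

(** The projection onto the cokernel and the zero map agree after composition
    with [f], hence are equal when [f] is an epimorphism. *)
Lemma dm_epi_surj : dm_epi f -> forall w, exists v, f v = w.
Proof.
move=> ef w; apply/dm_imageP; rewrite -[w]subr0; apply/coker_projP.
rewrite raddf0; apply: (ef _ coker_hom (zero_hom _)) => v /=.
apply/eqP; rewrite -[X in _ == X](raddf0 coker_proj); apply/eqP/coker_projP.
by rewrite subr0; apply/dm_imageP; exists v.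
Qed.

End Cokernel.

Lemma dm_surj_epi (G : topologicalGroupType) (k : fieldType)
    (A B : discreteModule G k) (f : dm_hom A B) :
  (forall w, exists v, f v = w) -> dm_epi f.
Proof. by move=> fs X u v uv w; have [x <-] := fs w; exact: uv. Qed.


(** * Direct sums of the modules k[G/N] *)

Section PermutationModule.
Variables (G : topologicalGroupType) (k : fieldType) (I : choiceType).
Variable N : I -> set G.

(** The elements of (+)_i k[G/N_i] as functions of [i] and of [x] in [G], where
    [phi i x] is the coefficient of the coset [x N_i]: right [N_i]-invariant in
    [x] and zero for almost all [i]. *)
Definition perm_pred : {pred I -> G -> k^o} :=
  [pred phi | `[< (forall i, right_invariant (N i) (phi i)) /\
    exists s : seq I, forall i, i \notin s -> phi i = 0 >]].

Record perm_fun := PermFun {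
  perm_val :> I -> G -> k^o;
  _ : perm_val \in perm_pred
}.

HB.instance Definition _ := [isSub for perm_val].
HB.instance Definition _ := [Choice of perm_fun by <:].

Lemma perm_pred_submod_closed : submod_closed perm_pred.
Proof.
split=> [|a phi psi /asboolP[phiN [s phis]] /asboolP[psiN [t psit]]];
  apply/asboolP; first by split=> [//|]; exists [::].
split=> [i x n Nn|].
  change (a *: phi i (x * n)%g + psi i (x * n)%g = a *: phi i x + psi i x).
  by rewrite phiN ?psiN.
exists (s ++ t) => i; rewrite mem_cat negb_or => /andP[si ti].
change (a *: phi i + psi i = 0).
by rewrite phis ?psit // scaler0 addr0.
Qed.

HB.instance Definition _ :=
  GRing.isSubmodClosed.Build k (I -> G -> k^o) perm_pred
    perm_pred_submod_closed.
HB.instance Definition _ := [SubChoice_isSubLmodule of perm_fun by <:].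

Lemma perm_funP (phi psi : perm_fun) :
  (forall i x, phi i x = psi i x) -> phi = psi.
Proof. by move=> e; apply/val_inj/funext => i; apply/funext => x; exact: e. Qed.

Lemma perm_inv (phi : perm_fun) i : right_invariant (N i) (phi i).
Proof. by case: phi => phi /= /asboolP[]. Qed.

Lemma perm_support (phi : perm_fun) :
  exists s : seq I, forall i, i \notin s -> phi i = 0.
Proof. by case: phi => phi /= /asboolP[]. Qed.

Definition perm_eval i x (phi : perm_fun) : k^o := phi i x.

Lemma perm_eval_linear i x : linear (perm_eval i x).
Proof. by []. Qed.

HB.instance Definition _ i x := GRing.isLinear.Build k perm_fun k^o *:%R
  (perm_eval i x) (@perm_eval_linear i x).

Lemma perm_act_subproof (g : G) (phi : perm_fun) :
  (fun i x => phi i (g^-1 * x)%g) \in perm_pred.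
Proof.
apply/asboolP; split=> [i x n Nn|]; first by rewrite mulgA perm_inv.
have [s phis] := perm_support phi; exists s => i si.
by apply/funext => x; rewrite phis.
Qed.

Definition perm_act g phi := PermFun (perm_act_subproof g phi).

Lemma perm_act_linear g : linear (perm_act g).
Proof. by move=> a phi psi; exact: perm_funP. Qed.

HB.instance Definition _ g := GRing.isLinear.Build k perm_fun perm_fun *:%R
  (perm_act g) (@perm_act_linear g).

Lemma perm_act1 phi : perm_act 1%g phi = phi.
Proof. by apply: perm_funP => i x /=; rewrite invg1 mul1g. Qed.

Lemma perm_actM g h phi : perm_act (g * h)%g phi = perm_act g (perm_act h phi).
Proof. by apply: perm_funP => i x /=; rewrite invgM mulgA. Qed.

Hypothesis cG : compact [set: G].
Hypothesis nN : forall i, open_normal_subgroup (N i).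

Lemma perm_left_inv (phi : perm_fun) i n x : N i n -> phi i (n * x)%g = phi i x.
Proof.
by move=> Nn; rewrite conjgC perm_inv //; exact: open_normalJ.
Qed.

Lemma perm_act_continuous :
  continuous ((fun z => perm_act z.1 z.2) :
      G * discrete_topology perm_fun -> discrete_topology perm_fun).
Proof.
apply: (smooth_continuous (act := fun g => perm_act g) perm_actM) => phi.
have [s phis] := perm_support phi.
have [L [nL Ls]] : exists L, open_normal_subgroup L /\
    forall i, i \in s -> L `<=` N i.
  elim: s {phis} => [|i s [L [nL Ls]]].
    by exists setT; split=> //; exact: open_normalT.
  exists (N i `&` L); split=> [|j]; first exact: open_normalI.
  by rewrite inE => /predU1P[->|/Ls Lj] x [] // _ /Lj.
exists L; split=> // n Ln; apply: perm_funP => i x /=.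
have [si|si] := boolP (i \in s); last by rewrite phis.
by rewrite perm_left_inv //; apply: open_normalV => //; exact: Ls.
Qed.

Definition perm_module : discreteModule G k :=
  @DiscreteModule G k perm_fun (fun g => perm_act g) perm_act1 perm_actM
    perm_act_continuous.

Section Extension.
Variable A : discreteModule G k.
Implicit Type a : I -> A.

Definition fixed_family a := forall i n, N i n -> dm_act A n (a i) = a i.

Definition perm_term a (phi : perm_fun) i : A :=
  coset_sum (N i) (fun x => phi i x *: dm_act A x (a i)).

(** The extension to the direct sum of the map sending the generator of
    k[G/N_i] to [a i]. *)
Definition perm_ext a (phi : perm_fun) : A :=
  \sum_(i \in [set: I]) perm_term a phi i.

Lemma perm_extE a (phi : perm_fun) (s : seq I) :
  uniq s -> (forall i, i \notin s -> phi i = 0) ->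
  perm_ext a phi = \sum_(i <- s) perm_term a phi i.
Proof.
move=> us phis.
rewrite fsbig_seq //; apply/esym/fsbig_widen => // i [_ /negP si] /=.
by rewrite /perm_term /coset_sum big1 // => x _; rewrite phis ?scale0r.
Qed.

Lemma perm_support2 (phi psi : perm_fun) : exists s : seq I, uniq s /\
  forall i, i \notin s -> phi i = 0 /\ psi i = 0.
Proof.
have [[s phis] [t psit]] := (perm_support phi, perm_support psi).
exists (undup (s ++ t)); split=> [|i]; first exact: undup_uniq.
by rewrite mem_undup mem_cat negb_or => /andP[/phis ? /psit].
Qed.

Lemma perm_ext_linear a : linear (perm_ext a).
Proof.
move=> c phi psi; have [s [us sP]] := perm_support2 phi psi.
rewrite !(@perm_extE a _ s us); [|by move=> i /sP[]..|]; last first.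
  move=> i /sP[phi0 psi0]; change (c *: phi i + psi i = 0).
  by rewrite phi0 psi0 scaler0 addr0.
rewrite scaler_sumr -big_split; apply: eq_bigr => i _ /=.
rewrite /perm_term /coset_sum scaler_sumr -big_split; apply: eq_bigr => x _ /=.
by rewrite scalerA -scalerDl.
Qed.

HB.instance Definition _ a := GRing.isLinear.Build k perm_fun A *:%R
  (perm_ext a) (@perm_ext_linear a).

Lemma perm_extJ a g phi : fixed_family a ->
  perm_ext a (perm_act g phi) = dm_act A g (perm_ext a phi).
Proof.
move=> aN; have [s [us sP]] := perm_support2 phi phi.
rewrite !(@perm_extE a _ s us); [|by move=> i /sP[]|]; last first.
  by move=> i /sP[phi0 _]; apply/funext => x; rewrite /= phi0.
rewrite linear_sum; apply: eq_bigr => i _.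
rewrite /perm_term -(@coset_sum_translate _ cG _ _ _ g (nN i)).
  rewrite linear_sum; apply: eq_bigr => x _ /=.
  by rewrite mulKg dm_actM linearZ.
move=> x n Nn /=.
by rewrite mulgA (perm_inv phi) // dm_actM aN.
Qed.

Definition perm_ext_hom a (aN : fixed_family a) : dm_hom perm_module A :=
  @DmHom G k perm_module A (perm_ext a : {linear perm_fun -> A})
    (fun g phi => perm_extJ g phi aN).

End Extension.

Lemma perm_ext_natural (A B : discreteModule G k) (f : dm_hom A B) a phi :
  f (perm_ext a phi) = perm_ext (f \o a) phi.
Proof.
have [s [us sP]] := perm_support2 phi phi.
have phis i : i \notin s -> phi i = 0 by move=> /sP[].
rewrite !(perm_extE _ us phis) linear_sum; apply: eq_bigr => i _.
rewrite /perm_term /coset_sum linear_sum; apply: eq_bigr => x _ /=.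
by rewrite linearZ /= dm_homJ.
Qed.

Lemma perm_gen_subproof i :
  (fun j x => if (j == i) && `[< N i x >] then 1 else 0 : k^o) \in perm_pred.
Proof.
apply/asboolP; split=> [j x n Nn|].
  by case: eqP Nn => //= -> Nn; rewrite open_normalMr.
exists [:: i] => j; rewrite inE => /negPf ->; exact/funext.
Qed.

(** The generator of k[G/N_i], namely the coset of 1. *)
Definition perm_gen i : perm_module := PermFun (perm_gen_subproof i).

Lemma perm_gen_fixed : fixed_family perm_gen.
Proof.
move=> i n Nn; apply: perm_funP => j x /=.
by rewrite open_normalMl //; exact: open_normalV.
Qed.

Lemma perm_ext_genE (A : discreteModule G k) (a : I -> A) i :
  fixed_family a -> perm_ext a (perm_gen i) = a i.
Proof.
move=> aN; rewrite (@perm_extE _ a _ [:: i]) //; last first.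
  by move=> j; rewrite inE => /negPf ji; apply/funext => x; rewrite /= ji.
rewrite big_seq1 /perm_term /coset_sum /= eqxx /=.
under eq_bigr => x _.
  rewrite (_ : _ *: _ = if `[< N i (1^-1 * x)%g >] then a i else 0).
    over.
  rewrite invg1 mul1g; case: asboolP => [Nx|_]; last by rewrite scale0r.
  by rewrite scale1r aN.
by rewrite -big_mkcond /= sumr_count coset_repsP.
Qed.

(** The generators span: the extension of their own inclusion is the
    identity. *)
Lemma perm_ext_gen phi : perm_ext perm_gen phi = phi.
Proof.
apply: perm_funP => j y; have [t phit] := perm_support phi.
pose s := undup (j :: t).
have phis i : i \notin s -> phi i = 0.
  by rewrite mem_undup inE negb_or => /andP[_]; exact: phit.
rewrite -/(perm_eval j y _) (perm_extE _ _ phis) ?undup_uniq // linear_sum.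
have js : j \in s by rewrite mem_undup mem_head.
rewrite (bigD1_seq j) ?undup_uniq //= [X in _ + X]big1 ?addr0 => [|i ij].
  rewrite /perm_term /coset_sum linear_sum.
  rewrite -[RHS]mulr1n -(coset_repsP cG (nN j) y) -sumr_count big_mkcond /=.
  rewrite [RHS]big_mkcond /=; apply: eq_bigr => x _.
  change (phi j x * (if (j == j) && `[< N j (x^-1 * y)%g >] then 1 else 0) =
    if `[< N j (y^-1 * x)%g >] then phi j y else 0).
  rewrite eqxx /=; case: asboolP => [Nxy|Nxy].
    rewrite asboolT; last exact: open_normal_div.
    by rewrite mulr1 -[y in RHS](mulVKg x) perm_inv.
  by rewrite mulr0 asboolF // => /(open_normal_div (nN j)).
rewrite /perm_term /coset_sum linear_sum big1 // => x _.
change (phi i x * (if (j == i) && `[< N i (x^-1 * y)%g >] then 1 else 0) = 0).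
by rewrite eq_sym (negPf ij) mulr0.
Qed.

(** If the relative indices of the open normal subgroups of the [N i] are
    invertible in [k], averaging makes any preimage of an [N i]-fixed vector
    fixed by [N i], so that the images of the generators can be lifted. *)
Lemma perm_module_projective :
  (forall i L, open_normal_subgroup L -> L `<=` N i ->
     (rel_index (N i) L)%:R != 0 :> k) ->
  dm_projective perm_module.
Proof.
move=> idx A B f g ef; have fs := dm_epi_surj cG ef.
have lift i : exists v, (forall n, N i n -> dm_act A n v = v) /\
    f v = g (perm_gen i).
  have [w fw] := fs (g (perm_gen i)).
  have [L0 [nL0 L0w]] := fixing_subgroup cG w.
  pose L := L0 `&` N i.
  have nL : open_normal_subgroup L by exact: open_normalI.
  have LN : L `<=` N i by move=> x [].
  (* The sum of F over G / L is the sum of x w over N i / L. *)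
  pose F x := if `[< N i x >] then dm_act A x w else 0.
  have FL : right_invariant L F.
    by move=> x n [L0n Nn]; rewrite /F dm_actM L0w // open_normalMr.
  exists ((rel_index (N i) L)%:R^-1 *: coset_sum L F); split=> [n Nn|].
    rewrite linearZ /=; congr (_ *: _).
    rewrite -[in RHS](coset_sum_translate cG n nL FL).
    rewrite /coset_sum linear_sum; apply: eq_bigr => x _ /=.
    by rewrite /F open_normalMl //; case: ifP; rewrite ?linear0 ?dm_actM.
  rewrite linearZ /= /coset_sum linear_sum.
  (* Each representative in N i contributes f (x w) = g (perm_gen i). *)
  have -> : \sum_(x <- coset_reps L) f (F x) =
      \sum_(x <- coset_reps L) (if `[< N i x >] then g (perm_gen i) else 0).
    apply: eq_bigr => x _; rewrite /F.
    case: asboolP => Nx; last by rewrite linear0.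
    by rewrite dm_homJ fw -dm_homJ perm_gen_fixed.
  rewrite -big_mkcond sumr_count -scaler_nat scalerA.
  by rewrite mulVf ?scale1r //; exact: idx.
have [a /all_and2[aN fa]] := choice lift.
exists (perm_ext_hom aN) => phi /=.
rewrite perm_ext_natural (_ : f \o a = g \o perm_gen); last exact/funext.
by rewrite -perm_ext_natural perm_ext_gen.
Qed.

End PermutationModule.

(** * The exponent of a prime in the order of the group *)

Section Exponent.
Variable G : topologicalGroupType.
Hypothesis cG : compact [set: G].
Variable l : {l : nat | prime l}.
Implicit Types N H L : set G.

Lemma group_order_ub N e : open_normal_subgroup N ->
  group_order G l = Some e -> (logn (val l) (size (coset_reps N)) <= e)%N.
Proof.
move=> nN Ge.
have /supernatural_lcm_ub/(_ l) : [set s | exists (H : set G) (n : nat),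
    [/\ open_normal_subgroup H, left_cosets H #= `I_n &
        s = supernatural_of_nat n]]
    (supernatural_of_nat (size (coset_reps N))).
  by exists N, (size (coset_reps N)); split=> //; exact: card_left_cosets.
by rewrite -/(group_order G) Ge.
Qed.

Lemma group_order_unbounded e : group_order G l = None ->
  exists N,
    open_normal_subgroup N /\ (e < logn (val l) (size (coset_reps N)))%N.
Proof.
move=> Goo; apply: contrapT => noN.
have : supernatural_dvd (group_order G)
    (fun l' => if l' == l then Some e else None).
  apply: supernatural_lcm_least => _ [H [n [nH cH ->]]] l' /=.
  case: eqP => // ->; rewrite leqNgt; apply/negP => en; apply: noN.
  exists H; split=> //; suff <- : n = size (coset_reps H) by [].
  apply/card_eq_II.
  exact: card_eq_trans (card_esym cH) (card_left_cosets cG nH).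
by move=> /(_ l); rewrite Goo eqxx.
Qed.

End Exponent.

Lemma rel_index_gt0 (G : topologicalGroupType) (N L : set G) :
  compact [set: G] -> open_normal_subgroup N -> open_normal_subgroup L ->
  N `<=` L -> (0 < rel_index L N)%N.
Proof.
move=> cG nN nL NL; have := coset_reps_gt0 cG nN.
by rewrite (index_mul cG nN nL NL) muln_gt0 => /andP[].
Qed.

Lemma rel_index_mul (G : topologicalGroupType) (N L H : set G) :
  compact [set: G] -> open_normal_subgroup N -> open_normal_subgroup L ->
  open_normal_subgroup H -> N `<=` L -> L `<=` H ->
  rel_index H N = (rel_index H L * rel_index L N)%N.
Proof.
move=> cG nN nL nH NL LH; apply/eqP.
rewrite -(eqn_pmul2l (coset_reps_gt0 cG nH)) mulnA.
by rewrite -!index_mul //; exact: subset_trans LH.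
Qed.

(** In characteristic 0 take [H = G].  Otherwise take [H] of index with maximal
    [p]-adic valuation: since [G : L] = [G : H] [H : L], the prime [p] cannot
    divide [H : L]. *)
Lemma finite_exponent_invertible_index (G : topologicalGroupType)
    (k : fieldType) (p : nat) :
  compact [set: G] -> has_characteristic k p ->
  has_finite_exponent p (group_order G) ->
  exists H : set G, open_normal_subgroup H /\
    forall L, open_normal_subgroup L -> L `<=` H ->
      (rel_index H L)%:R != 0 :> k.
Proof.
move=> cG [[_ /pcharf0P k0] _|kp fin].
  exists setT; split=> [|L nL LT]; first exact: open_normalT.
  by rewrite k0 -lt0n rel_index_gt0 //; exact: open_normalT.
have pp := pcharf_prime kp; pose l : {l : nat | prime l} := exist _ p pp.
case Ge : (group_order G l) => [e|]; last by have := fin l erefl; rewrite Ge.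
pose E n := `[< exists N : set G, open_normal_subgroup N /\
  logn p (size (coset_reps N)) = n >].
have exE : exists n, E n.
  by exists (logn p (size (coset_reps [set: G]))); apply/asboolP; exists setT;
     split=> //; exact: open_normalT.
have ubE n : E n -> (n <= e)%N.
  by move=> /asboolP[N [nN <-]]; exact: (group_order_ub (l := l) cG nN Ge).
have [n /asboolP[H [nH Hn]] nmax] := ex_maxnP exE ubE.
exists H; split=> // L nL LH; rewrite -(dvdn_pcharf kp).
have /nmax : E (logn p (size (coset_reps L))) by apply/asboolP; exists L.
have i0 := rel_index_gt0 cG nL nH LH.
rewrite (index_mul cG nL nH LH) lognM ?coset_reps_gt0 // Hn.
by rewrite -{2}[n]addn0 leq_add2l leqn0 eqn0Ngt logn_gt0 mem_primes pp i0.
Qed.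

(** Intersect [L] with some [H] whose index has larger valuation than that of
    [L], and compare the two factorisations of the index of [H] /\ [L]. *)
Lemma infinite_exponent_divisible_index (G : topologicalGroupType)
    (l : {l : nat | prime l}) (L : set G) :
  compact [set: G] -> group_order G l = None -> open_normal_subgroup L ->
  exists N, [/\ open_normal_subgroup N, N `<=` L & (val l %| rel_index L N)%N].
Proof.
move=> cG Goo nL.
have [H [nH LH]] :=
  group_order_unbounded cG (logn (val l) (size (coset_reps L))) Goo.
have nI := open_normalI nH nL.
exists (H `&` L); split=> //.
have iH := rel_index_gt0 cG nI nH (@subIsetl _ _ _).
have iL := rel_index_gt0 cG nI nL (@subIsetr _ _ _).
have e : (logn (val l) (size (coset_reps H)) +
            logn (val l) (rel_index H (H `&` L)) =
          logn (val l) (size (coset_reps L)) +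
            logn (val l) (rel_index L (H `&` L)))%N.
  rewrite -!lognM ?coset_reps_gt0 //.
  by rewrite -(index_mul cG nI nH (@subIsetl _ _ _))
             -(index_mul cG nI nL (@subIsetr _ _ _)).
suff : (0 < logn (val l) (rel_index L (H `&` L)))%N.
  by rewrite logn_gt0 mem_primes => /and3P[].
rewrite -(ltn_add2l (logn (val l) (size (coset_reps L)))) addn0.
by rewrite -[X in (_ < X)%N]e (leq_trans LH) // leq_addr.
Qed.

(** * Projective objects *)

Section Projectives.
Variables (G : topologicalGroupType) (k : fieldType).
Hypothesis cG : compact [set: G].

Lemma fixing_subgroup_in (H : set G) (M : discreteModule G k) :
  open_normal_subgroup H -> exists N : M -> set G, forall v,
    [/\ open_normal_subgroup (N v), N v `<=` H &
        forall n, N v n -> dm_act M n v = v].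
Proof.
move=> nH; have /choice[N NP] : forall v : M, exists N0 : set G,
    [/\ open_normal_subgroup N0, N0 `<=` H &
        forall n, N0 n -> dm_act M n v = v].
  move=> v; have [N [nN Nv]] := fixing_subgroup cG v.
  exists (N `&` H).
  by split=> [||n [/Nv]//]; [exact: open_normalI|exact: subIsetr].
by exists N.
Qed.

Lemma perm_ext_surj (M : discreteModule G k) (N : M -> set G)
    (nN : forall v, open_normal_subgroup (N v)) (Nfix : fixed_family N id) v :
  exists phi, perm_ext_hom cG nN Nfix phi = v.
Proof. by exists (perm_gen k nN v); exact: perm_ext_genE. Qed.

Lemma enough_projectives_of_invertible_index (H : set G) :
  open_normal_subgroup H ->
  (forall L, open_normal_subgroup L -> L `<=` H ->
     (rel_index H L)%:R != 0 :> k) ->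
  has_enough_projectives G k.
Proof.
move=> nH idx M; have [N NP] := fixing_subgroup_in M nH.
have nN v : open_normal_subgroup (N v) by case: (NP v).
have Nfix : fixed_family N (id : M -> M) by move=> v; case: (NP v).
exists (perm_module k nN); split; last first.
  by exists (perm_ext_hom cG nN Nfix); exact: perm_ext_surj.
apply: (perm_module_projective cG) => v L nL LN.
have NH : N v `<=` H by case: (NP v).
have := idx L nL (subset_trans LN NH).
rewrite (rel_index_mul cG nL (nN v) nH LN NH) natrM mulf_eq0 negb_or.
by move=> /andP[].
Qed.

(** If the exponent were infinite, one could choose open normal subgroups K_w
    inside L_w, for w in the projective, with [p] dividing [L_w : K_w].  A
    section of the surjection from (+)_w k[G/K_w] would then exhibit [v] as a
    sum of multiples of these indices. *)
Lemma nonzero_projective_finite_exponent (p : nat) :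
  has_characteristic k p -> has_nonzero_projective G k ->
  has_finite_exponent p (group_order G).
Proof.
move=> kp [P [projP [v v0]]] l lp Goo.
have {}kp : p \in [pchar k].
  by case: kp => // -[p0 _]; have := valP l; rewrite lp p0.
have [N [nN Nv]] := fixing_subgroup cG v.
have [L LP] := fixing_subgroup_in P nN.
have /choice[K KP] : forall w, exists K0 : set G, [/\ open_normal_subgroup K0,
    K0 `<=` L w & (p %| rel_index (L w) K0)%N].
  move=> w; rewrite -lp.
  by apply: infinite_exponent_divisible_index => //; case: (LP w).
have nK w : open_normal_subgroup (K w) by case: (KP w).
have Kfix : fixed_family K (id : P -> P).
  move=> w n Kn; have [[_ _ Lw] [_ KL _]] := (LP w, KP w).
  by apply: Lw; exact: KL.
pose q := perm_ext_hom cG nK Kfix.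
pose idP : dm_hom P P :=
  @DmHom G k P P (idfun : {linear P -> P}) (fun g v => erefl).
have [s qs] := projP _ _ q idP (dm_surj_epi (perm_ext_surj nK Kfix)).
have sN (w : P) x n : N n ->
    (s v : perm_fun k K) w (n * x)%g = (s v : perm_fun k K) w x.
  move=> Nn; have := dm_homJ s (n^-1)%g v.
  rewrite Nv; last exact: open_normalV.
  by move=> e; rewrite {2}e /= invgK.
have := qs v; rewrite /= => vE; move: v0; rewrite -vE.
rewrite /perm_ext fsbig1 ?eqxx // => w _.
have [nL LN Lw] := LP w; have [_ KL pKL] := KP w.
rewrite /perm_term (coset_sum_sub cG (nK w) nL KL).
  rewrite -scaler_nat (eqP (_ : (rel_index _ _)%:R == 0)) ?scale0r //.
  by rewrite -(dvdn_pcharf kp).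
move=> x n Ln /=; rewrite dm_actM Lw //; congr (_ *: _).
(* x n = (x n x^-1) x, and x n x^-1 lies in N, which fixes s v. *)
by rewrite conjgCV; apply: sN; apply: open_normalJ => //; exact: LN.
Qed.

End Projectives.

Section TrivialModule.
Variables (G : topologicalGroupType) (k : fieldType).

Lemma trivial_act_continuous :
  continuous ((fun z => z.2) :
      G * discrete_topology k^o -> discrete_topology k^o).
Proof.
apply: (smooth_continuous (act := fun=> idfun : {linear k^o -> k^o})) => // v.
by exists setT; split=> //; exact: open_normalT.
Qed.

Definition trivial_module : discreteModule G k :=
  @DiscreteModule G k k^o (fun=> idfun) (fun=> erefl) (fun _ _ _ => erefl)
    trivial_act_continuous.

Lemma enough_projectives_nonzero :
  has_enough_projectives G k -> has_nonzero_projective G k.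
Proof.
move=> enough; have [P [projP [f fs]]] := enough trivial_module.
have [w fw] := fs (1 : k^o); exists P; split=> //; exists w.
apply: contraPneq fw => ->; rewrite linear0.
by apply/nesym/eqP; exact: oner_neq0.
Qed.

End TrivialModule.

Theorem theorem3p1 (G : topologicalGroupType) (hG : profinite G)
    (k : fieldType) (p : nat) (hp : has_characteristic k p) :
  (has_nonzero_projective G k <-> has_enough_projectives G k) /\
  (has_enough_projectives G k <-> has_finite_exponent p (group_order G)).
Proof.
have [cG _ _] := hG.
have ac := nonzero_projective_finite_exponent cG hp.
have ba := @enough_projectives_nonzero G k.
have cb : has_finite_exponent p (group_order G) -> has_enough_projectives G k.
  move=> /(finite_exponent_invertible_index cG hp)[H [nH idx]].
  exact: enough_projectives_of_invertible_index idx.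
by split; split=> //; [move=> /ac|move=> /ba]; auto.
Qed.
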